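(* Consider the $GI^X/M/c/N$ queueing model with partial rejection and batch-size probability mass function $b(k)$, $k\ge 1$. Let $p^*(i,j)$ be the one-step transition probabilities of its Markov chain imbedded just before batch arrivals, and let $p(i,j)$ be the one-step transition probabilities of the Markov chain imbedded just before arrivals in the corresponding single-arrival $GI/M/c/N$ model. Then, for all $i,j\in\{0,1,\dots,N\}$, \[ p^*(i,j)=\sum_{k=1}^{N-i-1}p(i+k-1,j)\,b(k)+p(N-1,j)\,B^c(N-i), \] where $B^c(N-i)=\sum_{k=N-i}^{\infty}b(k)$.
   Context: The single-arrival $GI/M/c/N$ model: customers arrive one at a time to a system with $c\ge 1$ parallel identical servers that can hold at most $N$ customers in total (in service and waiting; $N\ge c$); a customer arriving when $N$ are present is lost. Inter-arrival times are i.i.d. with distribution function $A(t)$ on $[0,\infty)$; service times are i.i.d. exponential with mean $1/\mu$, independent of the arrivals. $p(i,j)$ is the probability that an arrival finds $j$ customers in the system given that the preceding arrival found $i$ customers. (For $i\le N-1$ these coincide with the transition probabilities of the infinite-capacity $GI/M/c$ model.) The $GI^X/M/c/N$ model with partial rejection is the same, except that customers arrive in batches: times between batch arrivals are i.i.d. with distribution function $A(t)$; batch sizes are i.i.d. with $b(k)=P(X=k)$, $k\ge 1$ (so $b(0)=0$); inter-arrival times, batch sizes and service times are mutually independent. A batch that would bring the system state above $N$ is partially accepted: exactly enough of its customers are admitted to bring the state to $N$ and the rest of the batch is rejected. $p^*(i,j)$ is the probability that a batch finds $j$ customers in the system given that the preceding batch found $i$ customers. Empty sums are $0$. *)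

(* Defs.v *)
From HB Require Import structures.
From mathcomp Require Import all_boot all_order all_algebra.
From mathcomp Require Import all_classical all_reals all_analysis.

Set Implicit Arguments.
Unset Strict Implicit.
Unset Printing Implicit Defensive.

Import Order.TTheory GRing.Theory Num.Theory.
Local Open Scope classical_set_scope.
Local Open Scope ring_scope.

Section Probability.
Context d (Omega : measurableType d) (R : realType) (P : probability Omega R).

Definition sigma_rv d' (T' : measurableType d') (X : Omega -> T') :
    set (set Omega) :=
  preimage_set_system setT X measurable.

Definition mutually_independent (I : eqType) (F : I -> set (set Omega)) :=
  forall (J : seq I) (E : I -> set Omega), uniq J ->
    (forall i, i \in J -> F i (E i)) ->
    P (\bigcap_(i in [set` J]) E i) = (\prod_(i <- J) P (E i))%E.

Definition cond_prob (E F : set Omega) : R :=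
  fine (P (E `&` F)) / fine (P F).

Definition has_cdf (X : {RV P >-> R}) (A : R -> R) :=
  forall t : R, cdf X t = (A t)%:E.

Definition has_exponential_law (mu : R) (X : {RV P >-> R}) :=
  forall B : set R, measurable B -> distribution P X B = exponential_prob mu B.

Definition has_pmf (X : {RV P >-> nat}) (b : nat -> R) :=
  forall k : nat, P (X @^-1` [set k]) = (b k)%:E.

(* [L i0 n] is the number of customers found by the [n]-th arrival when the
   zeroth arrival finds [i0] customers; [p i j] must be the conditional
   probability of [i -> j] at every step [n] and from every initial state
   [i0 <= N], whenever the conditioning event is not null. *)
Definition transition_probabilities (N : nat) (L : nat -> nat -> Omega -> nat)
    (p : nat -> nat -> R) :=
  forall i0 n i j : nat, (i0 <= N)%N -> (i <= N)%N -> (j <= N)%N ->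
    P (L i0 n @^-1` [set i]) != 0%E ->
    p i j = cond_prob (L i0 n.+1 @^-1` [set j]) (L i0 n @^-1` [set i]).

End Probability.

(* Sample paths. A state is the list of the remaining service requirements of
   the customers present, in order of arrival; the first [c] of them are in
   service (first come, first served), each at unit rate, and the others wait. *)
Section SamplePaths.
Context (R : realType) (c N : nat).

(* Runs the system for a time [t] without arrivals. Each round advances the
   clock by [m], the time to the next service completion truncated at the
   remaining time, and removes the customers whose service is completed. All
   rounds but the last remove a customer, so [(size w).+1] rounds suffice; the
   superfluous rounds have [m = 0] and leave the state unchanged. *)
Fixpoint serve_rounds (rounds : nat) (t : R) (w : seq R) : seq R :=
  if rounds is r.+1 then
    let m := \big[Num.min/t]_(x <- take c w) x in
    serve_rounds r (t - m)
      ([seq y <- [seq x - m | x <- take c w] | 0 < y] ++ drop c w)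
  else w.

Definition serve (t : R) (w : seq R) : seq R := serve_rounds (size w).+1 t w.

Definition admit_single (w : seq R) (s : R) : seq R :=
  if (size w < N)%N then rcons w s else w.

(* [s k] is the service time of the [k]-th customer of the batch; the batch is
   truncated to the number of free places. *)
Definition admit_batch (w : seq R) (x : nat) (s : nat -> R) : seq R :=
  w ++ mkseq s (minn x (N - size w)).

(* State just before the [n]-th arrival, when the zeroth arrival finds [i0]
   customers with remaining service times [V 0, ..., V (i0 - 1)]. *)
Fixpoint single_state (V T S : nat -> R) (i0 n : nat) : seq R :=
  if n is m.+1 then serve (T m) (admit_single (single_state V T S i0 m) (S m))
  else mkseq V i0.

Fixpoint batch_state (V T : nat -> R) (X : nat -> nat) (S : nat -> nat -> R)
    (i0 n : nat) : seq R :=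
  if n is m.+1 then
    serve (T m) (admit_batch (batch_state V T X S i0 m) (X m) (S m))
  else mkseq V i0.

End SamplePaths.

(* [T n]: time between arrivals [n] and [n + 1]; [S n]: service time of arriving
   customer [n]; [V k]: remaining service time at time zero of the [k]-th
   customer found by the zeroth arrival, exponential like every service time
   (residual service times are exponential by lack of memory). *)
Record GI_M_c_N d (Omega : measurableType d) (R : realType)
    (P : probability Omega R) (A : R -> R) (mu : R)
    (V T S : nat -> {RV P >-> R}) : Prop := {
  single_interarrival : forall n, has_cdf (T n) A ;
  single_service : forall n, has_exponential_law mu (S n) ;
  single_residual : forall k, has_exponential_law mu (V k) ;
  single_indep : mutually_independent P
    (fun u : nat + nat + nat => match u with
      | inl (inl k) => sigma_rv (V k)
      | inl (inr n) => sigma_rv (T n)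
      | inr n => sigma_rv (S n)
      end) }.

(* [X n]: size of batch [n]; [S n k]: service time of the [k]-th customer of
   batch [n]. *)
Record GIX_M_c_N d (Omega : measurableType d) (R : realType)
    (P : probability Omega R) (A : R -> R) (b : nat -> R) (mu : R)
    (V T : nat -> {RV P >-> R}) (X : nat -> {RV P >-> nat})
    (S : nat -> nat -> {RV P >-> R}) : Prop := {
  batch_interarrival : forall n, has_cdf (T n) A ;
  batch_size : forall n, has_pmf (X n) b ;
  batch_service : forall n k, has_exponential_law mu (S n k) ;
  batch_residual : forall k, has_exponential_law mu (V k) ;
  batch_indep : mutually_independent P
    (fun u : nat + nat + nat + nat * nat => match u with
      | inl (inl (inl k)) => sigma_rv (V k)
      | inl (inl (inr n)) => sigma_rv (T n)
      | inl (inr n) => sigma_rv (X n)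
      | inr nk => sigma_rv (S nk.1 nk.2)
      end) }.

Section ImbeddedChains.
Context d (Omega : measurableType d) (R : realType) (P : probability Omega R).

Definition single_found (c N : nat) (V T S : nat -> {RV P >-> R})
    (i0 n : nat) (omega : Omega) : nat :=
  size (single_state c N (fun k => V k omega) (fun m => T m omega)
    (fun m => S m omega) i0 n).

Definition batch_found (c N : nat) (V T : nat -> {RV P >-> R})
    (X : nat -> {RV P >-> nat}) (S : nat -> nat -> {RV P >-> R})
    (i0 n : nat) (omega : Omega) : nat :=
  size (batch_state c N (fun k => V k omega) (fun m => T m omega)
    (fun m => X m omega) (fun m k => S m k omega) i0 n).

End ImbeddedChains.

(* Upper tail [B^c(m) = \sum_(k >= m) b k]. *)
Definition upper_tail (R : realType) (b : nat -> R) (m : nat) : R :=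
  \big[+%R/0]_(m <= k <oo) b k.

(* Main.v *)
Require Import Defs.
From HB Require Import structures.
From mathcomp Require Import all_boot all_order all_algebra.
From mathcomp Require Import all_classical all_reals all_analysis.
From mathcomp Require Import measurable_realfun.

Set Implicit Arguments.
Unset Strict Implicit.
Unset Printing Implicit Defensive.

Import Order.TTheory GRing.Theory Num.Theory.
Import numFieldNormedType.Exports.
Local Open Scope classical_set_scope.
Local Open Scope ring_scope.

(** When an arrival finds [m < N] customers, its admission leaves [m + 1]
    customers in the system, and [p m j] is the probability that [j] of them
    remain after one interarrival time. When a batch of size [k] finds [i]
    customers, its partial admission leaves [n = minn (i + k) N] of them, so
    given the batch size the situation is that of a single arrival that finds
    [n - 1] customers. Summing over the batch sizes, those with [i + k < N]
    contribute [p (i + k - 1) j * b k] each, and all the others together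
    contribute [p (N - 1) j] times their total probability, the upper tail.

    The first step of the chains is enough: the zeroth arrival finds a
    prescribed number of customers, so its conditioning event is the whole
    space, and the customers present right after it have independent exponential
    service requirements by hypothesis.

    What has to be proved is that the two situations really have the same
    distribution. Both are obtained by one measurable map on tuples
    ([left_after_service], [measurable_left_after_service]), applied to an
    interarrival time and the service requirements of the customers present.
    These two random tuples live on different probability spaces, but have
    independent coordinates with the same laws, and in the batch model they are
    moreover independent of the batch size. As a finite measure on tuples is
    determined by its values on boxes ([measure_tuple_unique]), any event on the
    batch size is independent of the number of customers left, which is
    distributed as in the single-arrival model ([batch_service_law]). *)

(** * Laws of random tuples *)

(** Boxes are stable under intersection and generate the product sigma-algebra,
    which is defined from the cylinders over one coordinate: such a cylinder is
    a box with all other sides full. *)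
Lemma measure_tuple_unique d (T : measurableType d) (R : realType) (n : nat)
    (m1 m2 : {measure set (n.-tuple T) -> \bar R}) :
  (forall E : 'I_n -> set T, (forall i, measurable (E i)) ->
    m1 [set x | forall i, E i (tnth x i)] =
    m2 [set x | forall i, E i (tnth x i)]) ->
  (m1 setT < +oo)%E ->
  forall B, measurable B -> m1 B = m2 B.
Proof.
move=> m12 m1oo B mB.
pose G := [set C : set (n.-tuple T) | exists2 E : 'I_n -> set T,
  forall i, measurable (E i) & C = [set x | forall i, E i (tnth x i)]].
have GT : G setT.
  by exists (fun=> setT) => //; apply/seteqP; split.
have Gm : G `<=` measurable.
  move=> _ [E mE ->].
  rewrite [X in measurable X](_ : _ = \bigcap_(i in [set: 'I_n])
      ((fun x : n.-tuple T => tnth x i) @^-1` E i)); last first.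
    by apply/seteqP; split => [x h i _|x h i]; exact: h.
  apply: fin_bigcap_measurable => [|i _]; first exact: finite_finset.
  by rewrite -[X in measurable X]setTI; exact: measurable_tnth.
apply: (@g_sigma_algebra_measure_unique _ _ _ G Gm (fun=> setT) (fun=> GT)).
- by rewrite bigcup_const//; exists 0%N.
- move=> _ _ [E mE ->] [F mF ->]; exists (fun i => E i `&` F i).
    by move=> i; exact: measurableI.
  apply/seteqP; split => x /=; first by case=> hE hF i.
  by move=> h; split=> i; case: (h i).
- by move=> _ [E mE ->]; exact: m12.
- by [].
- move: B mB; apply: smallest_sub; first exact: smallest_sigma_algebra.
  rewrite -bigcup_seq => C [i _ [E mE <-]]; apply: sub_sigma_algebra.
  exists (fun k => if k == i then E else setT).
    by move=> k; case: ifP.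
  rewrite setTI; apply/seteqP; split => x /=.
    by move=> Ex k; case: eqP => // ->.
  by move=> /(_ i); rewrite eqxx.
Qed.

(** The open right half-lines are stable under intersection and generate the
    Borel sets; the one that starts at [x] has probability one minus the
    distribution function at [x]. *)
Lemma law_eq_of_cdf (R : realType)
    d1 (Omega1 : measurableType d1) (P1 : probability Omega1 R)
    d2 (Omega2 : measurableType d2) (P2 : probability Omega2 R)
    (X1 : {RV P1 >-> R}) (X2 : {RV P2 >-> R}) :
  (forall t, cdf X1 t = cdf X2 t) ->
  forall B, measurable B -> distribution P1 X1 B = distribution P2 X2 B.
Proof.
move=> cdf12 B mB.
have {}mB : <<s @RGenOInfty.G R >> B.
  by rewrite -[<<s _ >>](RGenOInfty.measurableE R).
have GmE (r : R) : ~` `]-oo, r]%classic = `]r, +oo[%classic by rewrite setCitvl.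
apply: (@g_sigma_algebra_measure_unique _ _ _ (@RGenOInfty.G R) _
  (fun n => `]- n%:R, +oo[%classic)) => //.
- by move=> _ [x ->]; exact: measurable_itv.
- by move=> n; exists (- n%:R).
- apply/seteqP; split=> // x _; exists (Num.truncn (- x)).+1 => //=.
  by rewrite in_itv/= andbT ltrNl truncnS_gt.
- move=> _ _ [x ->] [y ->]; exists (Num.max x y).
  by apply/seteqP; split => z /=; rewrite !in_itv/= !andbT gt_max => /andP.
- move=> _ [x ->]; rewrite -GmE.
  apply: etrans (probability_setC (distribution P1 X1) (measurable_itv _)) _.
  apply/esym; apply: etrans (probability_setC _ (measurable_itv _)) _.
  by congr (1 - _)%E; rewrite -[LHS]/(cdf X2 x) -cdf12.
- by move=> n; apply: le_lt_trans (ltry 1); exact: probability_le1.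
Qed.

Lemma measurable_mktuple d (T : measurableType d) d' (Omega : measurableType d')
    (n : nat) (Y : nat -> {mfun Omega >-> T}) :
  measurable_fun [set: Omega] (fun w => [tuple Y k w | k < n]).
Proof.
apply/measurable_fun_tnthP => i.
by apply: (eq_measurable_fun (Y i)) => // w _ /=; rewrite tnth_mktuple.
Qed.

(** The factor [P2 D] makes this a transfer of law and an independence statement
    at once: for [D] full it says that the two tuples have the same law, and for
    any other [D] that moreover [D] is independent of the second tuple. The
    proof compares the restriction of [P2] to [D] with the multiple [P2 D] of
    [P1], both pushed forward to the space of tuples. *)
Lemma independent_tuple_law (R : realType) d (T : measurableType d) (n : nat)
    d1 (Omega1 : measurableType d1) (P1 : probability Omega1 R)
    d2 (Omega2 : measurableType d2) (P2 : probability Omega2 R)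
    (Y1 : nat -> {mfun Omega1 >-> T}) (Y2 : nat -> {mfun Omega2 >-> T})
    (D : set Omega2) :
  measurable D ->
  (forall E : nat -> set T, (forall k, measurable (E k)) ->
    P2 (D `&` \bigcap_(k in `I_n) (Y2 k @^-1` E k)) =
    (P2 D * P1 (\bigcap_(k in `I_n) (Y1 k @^-1` E k)))%E) ->
  forall B : set (n.-tuple T), measurable B ->
    P2 (D `&` [set w | B [tuple Y2 k w | k < n]]) =
    (P2 D * P1 [set w | B [tuple Y1 k w | k < n]])%E.
Proof.
move=> mD PE B mB.
(* Boxes are indexed by ordinals, the families [Y1] and [Y2] by naturals. *)
pose ext (E : 'I_n -> set T) k := if insub k is Some i then E i else setT.
have bigcapE d' (Om : measurableType d') (Y : nat -> {mfun Om >-> T}) E :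
    [set w | forall i, E i (tnth [tuple Y k w | k < n] i)] =
    \bigcap_(k in `I_n) (Y k @^-1` ext E k).
  apply/seteqP; split => w /= h.
    move=> k kn; rewrite /ext insubT /=.
    by have := h (Ordinal kn); rewrite tnth_mktuple.
  by move=> i; have := h i (ltn_ord i); rewrite tnth_mktuple /ext /= valK.
pose r : {nonneg R} := NngNum (fine_ge0 (measure_ge0 P2 D)).
have rE : (r%:num)%:E = P2 D by rewrite fineK// fin_num_measure.
have := @measure_tuple_unique _ T R n
  (pushforward (mrestr P2 mD) (fun w => [tuple Y2 k w | k < n]))
  (pushforward (mscale r P1) (fun w => [tuple Y1 k w | k < n])).
move=> /(_ (measurable_mktuple Y2) (measurable_mktuple Y1)).
rewrite /= /pushforward /mrestr /mscale /= rE => h.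
rewrite setIC; apply: h => //.
  move=> E mE; have mext k : measurable (ext E k).
    by rewrite /ext; case: insub.
  by rewrite /= setIC; move: (PE (ext E) mext); rewrite -!bigcapE.
by rewrite preimage_setT setTI ltey_eq fin_num_measure.
Qed.

(** Mutual independence speaks of families of events indexed by the labels of
    the variables; here the [n] events are selected through the labelling [a] and
    numbered from zero, so that [E] need not be a function of the label. *)
Lemma mutually_independent_prod d (Omega : measurableType d) (R : realType)
    (P : probability Omega R) (I : eqType) (F : I -> set (set Omega))
    (n : nat) (a : nat -> I) (E : nat -> set Omega) :
  mutually_independent P F ->
  {in gtn n &, injective a} ->
  (forall k, (k < n)%N -> F (a k) (E k)) ->
  P (\bigcap_(k in `I_n) E k) = (\prod_(k < n) P (E k))%E.
Proof.
move=> indep inj_a FE.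
have size_J : size (map a (iota 0 n)) = n by rewrite size_map size_iota.
have uniq_J : uniq (map a (iota 0 n)).
  rewrite map_inj_in_uniq ?iota_uniq// => x y.
  by rewrite !mem_iota !add0n/=; exact: inj_a.
have index_a k : (k < n)%N -> index (a k) (map a (iota 0 n)) = k.
  move=> kn; rewrite -[RHS](index_uniq (a k) _ uniq_J) ?size_J//.
  by rewrite (nth_map 0%N) ?size_iota// nth_iota.
have := indep _ (fun x => E (index x (map a (iota 0 n)))) uniq_J.
rewrite -(big_mkord xpredT (fun k => P (E k))) /index_iota subn0 big_map.
rewrite (_ : (\prod_(k <- iota 0 n) P (E k) = \prod_(k <- iota 0 n)
    P (E (index (a k) (map a (iota 0 n)))))%E); last first.
  by apply: eq_big_seq => k; rewrite mem_iota/= add0n => kn; rewrite index_a.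
move=> <-; last first.
  move=> _ /mapP[k + ->]; rewrite mem_iota add0n => /= kn.
  by rewrite index_a//; exact: FE.
congr (P _); apply/seteqP; split => w /= h.
  move=> _ /mapP[k + ->]; rewrite mem_iota add0n => /= kn.
  by rewrite index_a//; exact: h.
move=> k kn; have := h (a k); rewrite index_a//; apply.
by apply/mapP; exists k => //; rewrite mem_iota.
Qed.

(** * Measurability of the service dynamics *)

(** A random list of requirements is kept as a list of random variables, so that
    its length and order do not depend on the sample point. *)
Definition values d (Omega : measurableType d) (R : realType)
    (fs : seq {mfun Omega >-> R}) (o : Omega) : seq R :=
  [seq f o | f : {mfun Omega >-> R} <- fs].

(** The filtered list has a random length, but by the sign of each entry of [fs]
    the sample space splits into finitely many measurable pieces, on each of
    which the list of survivors is [values] of a fixed sublist. [gs] accumulates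
    the entries already known to survive. *)
Lemma measurable_filter_pos d (Omega : measurableType d) (R : realType)
    (K : Omega -> seq R -> Prop) :
  (forall fs : seq {mfun Omega >-> R},
    measurable [set o | K o (values fs o)]) ->
  forall gs fs hs : seq {mfun Omega >-> R},
    measurable [set o | K o (values gs o ++
      [seq y <- values fs o | 0 < y] ++
      values hs o)].
Proof.
move=> mK gs fs hs; rewrite /values; elim: fs gs => [|f fs IH] gs /=.
  by under eq_set do rewrite -map_cat; exact: mK.
have mf : measurable [set o | 0 < f o].
  have := @measurable_fun_ltr _ _ R setT (cst 0) f.
  move=> /(_ (measurable_cst _) (measurable_funPT f)).
  by move=> /(_ measurableT [set true] I); rewrite setTI.
rewrite [X in measurable X](_ : _ =
   ([set o | 0 < f o] `&`
    [set o | K o (values (rcons gs f) o ++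
      [seq y <- values fs o | 0 < y] ++
      values hs o)]) `|`
   (~` [set o | 0 < f o] `&`
    [set o | K o (values gs o ++
      [seq y <- values fs o | 0 < y] ++
      values hs o)])).
  apply: measurableU; apply: measurableI.
  - exact: mf.
  - exact: IH.
  - exact: measurableC.
  - exact: IH.
apply/seteqP; split => o /=.
  rewrite /values map_rcons cat_rcons.
  by case: ifP => fo h; [left|right]; split=> //; rewrite fo.
rewrite /values map_rcons cat_rcons.
by case=> [[fo h]|[/negP/negbTE fo h]]; rewrite fo.
Qed.

Lemma measurable_bigmin d (Omega : measurableType d) (R : realType)
    (t : {mfun Omega >-> R}) (fs : seq {mfun Omega >-> R}) :
  exists m : {mfun Omega >-> R}, forall o,
    m o = \big[Num.min/t o]_(x <- values fs o) x.
Proof.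
elim: fs => [|f fs [m mE]]; first by exists t => o; rewrite big_nil.
by exists (f \min m) => o /=; rewrite big_cons mE.
Qed.

Lemma measurable_size_serve_rounds d (Omega : measurableType d) (R : realType)
    (c j rounds : nat) (t : {mfun Omega >-> R}) (fs : seq {mfun Omega >-> R}) :
  measurable [set o | size (serve_rounds c rounds (t o) (values fs o)) = j].
Proof.
elim: rounds t fs => [|r IH] t fs /=.
  have [fsj|/eqP fsj] := eqVneq (size fs) j.
    rewrite [X in measurable X](_ : _ = setT)//.
    by apply/seteqP; split => o //= _; rewrite size_map.
  rewrite [X in measurable X](_ : _ = set0)//.
  by apply/seteqP; split => o //=; rewrite size_map.
have [m mE] := measurable_bigmin t (take c fs).
have := @measurable_filter_pos _ Omega R
  (fun o w => size (serve_rounds c r (t o - m o) w) = j) (IH (t \- m))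
  [::]
  [seq (f \- m : {mfun Omega >-> R}) | f : {mfun Omega >-> R} <- take c fs]
  (drop c fs).
rewrite [X in measurable X -> _](_ : _ =
  [set o | size (serve_rounds c r.+1 (t o) (values fs o)) = j])//.
apply/funext => o; rewrite /= -map_take -mE -map_drop.
by rewrite /values -!map_comp.
Qed.

(** Coordinate [0] is the time until the next arrival, the others are the
    requirements of the [n] customers present. *)
Definition left_after_service (R : realType) (c n j : nat) :
    set (n.+1.-tuple R) :=
  [set x | size (serve c (tnth x ord0)
    [seq tnth x (lift ord0 k) | k <- enum 'I_n]) = j].

Lemma measurable_left_after_service (R : realType) (c n j : nat) :
  measurable (@left_after_service R c n j).
Proof.
pose coord (k : 'I_n.+1) : {mfun n.+1.-tuple R >-> R} :=
  HB.pack (fun x : n.+1.-tuple R => tnth x k)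
    (isMeasurableFun.Build _ _ _ _ _ (@measurable_tnth _ R n.+1 k)).
have := measurable_size_serve_rounds c j n.+1 (coord ord0)
  [seq coord (lift ord0 k) | k <- enum 'I_n].
rewrite [X in measurable X -> _](_ : _ = @left_after_service R c n j)//.
apply/funext => x; rewrite /left_after_service /serve /=.
by rewrite size_map size_enum_ord /values -map_comp.
Qed.

Lemma measurable_left_after_service_sample d (Omega : measurableType d)
    (R : realType) (c n j : nat) (Y : nat -> {mfun Omega >-> R}) :
  measurable [set w | left_after_service c j [tuple Y k w | k < n.+1]].
Proof.
rewrite -[X in measurable X]setTI.
apply: (measurable_mktuple Y) => //; exact: measurable_left_after_service.
Qed.

(** * The imbedded chains at their first step *)

Lemma left_after_serviceE (R : realType) (Omega : Type) (c n j : nat)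
    (Y : nat -> Omega -> R) (w : Omega) :
  left_after_service c j [tuple Y k w | k < n.+1] =
  (size (serve c (Y 0%N w) (mkseq (fun k => Y k.+1 w) n)) = j).
Proof.
rewrite /left_after_service /mkset tnth_mktuple; congr (size (serve _ _ _) = _).
rewrite /mkseq -val_enum_ord -map_comp; apply: eq_map => k /=.
by rewrite tnth_mktuple /= /bump leq0n add1n.
Qed.

(** The random data of the first step, in the coordinates of
    [left_after_service]: in the single-arrival model [m] customers are present
    and one joins, in the batch model [i] are present and the batch follows. *)
Definition single_sample d (Omega : measurableType d) (R : realType)
    (P : probability Omega R) (V T S : nat -> {RV P >-> R}) (m k : nat) :
    {RV P >-> R} :=
  if k is l.+1 then (if (l < m)%N then V l else S 0%N) else T 0%N.

Definition batch_sample d (Omega : measurableType d) (R : realType)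
    (P : probability Omega R) (V T : nat -> {RV P >-> R})
    (S : nat -> nat -> {RV P >-> R}) (i k : nat) : {RV P >-> R} :=
  if k is l.+1 then (if (l < i)%N then V l else S 0%N (l - i)%N) else T 0%N.

(** Coordinates from [m + 2] on would repeat the one service time [S 0], so
    independence stops there. *)
Lemma single_sample_prod d (Omega : measurableType d) (R : realType)
    (P : probability Omega R) (A : R -> R) (mu : R)
    (V T S : nat -> {RV P >-> R}) (m : nat) (E : nat -> set R) :
  GI_M_c_N A mu V T S -> (forall k, measurable (E k)) ->
  P (\bigcap_(k in `I_m.+2) (single_sample V T S m k @^-1` E k)) =
  (\prod_(k < m.+2) P (single_sample V T S m k @^-1` E k))%E.
Proof.
move=> [_ _ _ indep] mE.
pose a k : nat + nat + nat := if k is l.+1 then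
  (if (l < m)%N then inl (inl l) else inr 0%N) else inl (inr 0%N).
apply: (mutually_independent_prod (a := a) indep).
  move=> [|k] [|l]; rewrite !inE /a !ltnS //; try by case: ifP.
  move=> km lm; case: ltnP => mk; case: ltnP => ml //=; first by move=> [->].
  move=> _; congr _.+1.
  by apply/eqP; rewrite eqn_leq (leq_trans km)// (leq_trans lm).
move=> [|k] km /=; first by exists (E 0%N) => //; rewrite setTI.
by case: ifP => _; exists (E k.+1) => //; rewrite setTI.
Qed.

(** The event on the batch size is one more independent event, put in front of
    those on the coordinates. *)
Lemma batch_sample_prod d (Omega : measurableType d) (R : realType)
    (P : probability Omega R) (A : R -> R) (b : nat -> R)
    (mu : R) (V T : nat -> {RV P >-> R}) (X : nat -> {RV P >-> nat})
    (S : nat -> nat -> {RV P >-> R})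
    (i n : nat) (K : set nat) (E : nat -> set R) :
  GIX_M_c_N A b mu V T X S -> (forall k, measurable (E k)) ->
  P (X 0%N @^-1` K `&`
     \bigcap_(k in `I_n) (batch_sample V T S i k @^-1` E k)) =
  (P (X 0%N @^-1` K) *
   \prod_(k < n) P (batch_sample V T S i k @^-1` E k))%E.
Proof.
move=> [_ _ _ _ indep] mE.
pose a k : nat + nat + nat + nat * nat :=
  match k with
  | 0 => inl (inr 0%N)
  | 1 => inl (inl (inr 0%N))
  | l.+2 => if (l < i)%N then inl (inl (inl l)) else inr (0%N, (l - i)%N)
  end.
pose F k :=
  if k is l.+1 then batch_sample V T S i l @^-1` E l else X 0%N @^-1` K.
have -> : X 0%N @^-1` K `&`
    \bigcap_(k in `I_n) (batch_sample V T S i k @^-1` E k) =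
    \bigcap_(k in `I_n.+1) F k.
  by rewrite !bigcap_mkord big_ord_recl.
have -> : (P (X 0%N @^-1` K) *
    \prod_(k < n) P (batch_sample V T S i k @^-1` E k) =
    \prod_(k < n.+1) P (F k))%E.
  by rewrite big_ord_recl.
apply: (mutually_independent_prod (a := a) indep).
  move=> [|[|k]] [|[|l]] _ _; rewrite /a //; try by case: ifP.
  case: ltnP => ki; case: ltnP => li //=; move=> [kl]; first by rewrite kl.
  by rewrite -(subnK ki) kl subnK.
move=> [|[|k]] km /=.
- by exists K => //; rewrite setTI.
- by exists (E 0%N) => //; rewrite setTI.
- by case: ifP => _; exists (E k.+1) => //; rewrite setTI.
Qed.

(** Once a batch has joined [i] customers, how many of [m + 1] customers are
    left at the next arrival depends neither on the batch size nor on how the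
    [m + 1] customers are shared between the two: all requirements are
    exponential with the same rate. *)
Lemma batch_service_law (R : realType) (c i m j : nat) (mu : R) (A : R -> R)
    (b : nat -> R)
    d1 (Omega1 : measurableType d1) (P1 : probability Omega1 R)
    (V1 T1 S1 : nat -> {RV P1 >-> R})
    d2 (Omega2 : measurableType d2) (P2 : probability Omega2 R)
    (V2 T2 : nat -> {RV P2 >-> R}) (X2 : nat -> {RV P2 >-> nat})
    (S2 : nat -> nat -> {RV P2 >-> R}) (K : set nat) :
  GI_M_c_N A mu V1 T1 S1 ->
  GIX_M_c_N A b mu V2 T2 X2 S2 ->
  P2 (X2 0%N @^-1` K `&` [set w | left_after_service c j
       [tuple batch_sample V2 T2 S2 i k w | k < m.+2]]) =
  (P2 (X2 0%N @^-1` K) * P1 [set w | left_after_service c j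
       [tuple single_sample V1 T1 S1 m k w | k < m.+2]])%E.
Proof.
move=> single batch.
have mX : measurable (X2 0%N @^-1` K) by exact: measurable_funPTI.
apply: (@independent_tuple_law R _ R m.+2 _ _ P1 _ _ P2
  (single_sample V1 T1 S1 m) (batch_sample V2 T2 S2 i)) => // [E mE|].
  rewrite (batch_sample_prod _ _ _ batch)// (single_sample_prod _ single)//.
  congr (_ * _)%E; apply: eq_bigr => -[[|k] /= _] _.
    apply: (@law_eq_of_cdf R _ _ P2 _ _ P1 (T2 0%N) (T1 0%N)) => // t.
    by rewrite (batch_interarrival batch) (single_interarrival single).
  have expo (Z1 : {RV P1 >-> R}) (Z2 : {RV P2 >-> R}) :
      has_exponential_law mu Z1 -> has_exponential_law mu Z2 ->
      P2 (Z2 @^-1` E k.+1) = P1 (Z1 @^-1` E k.+1).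
    by move=> h1 h2; exact: etrans (h2 _ (mE _)) (esym (h1 _ (mE _))).
  apply: expo; case: ifP => _.
  - exact: single_residual single _.
  - exact: single_service single _.
  - exact: batch_residual batch _.
  - exact: batch_service batch _ _.
exact: measurable_left_after_service.
Qed.

Lemma probability_split_nat d (Omega : measurableType d) (R : realType)
    (P : probability Omega R) (X : {RV P >-> nat}) (F : set Omega) (m : nat) :
  measurable F ->
  P F = (\sum_(0 <= k < m) P (X @^-1` [set k] `&` F) +
         P (X @^-1` [set k | (m <= k)%N] `&` F))%E.
Proof.
move=> mF.
have mX K : measurable (X @^-1` K `&` F).
  by apply: measurableI => //; exact: measurable_funPTI.
elim: m => [|m IH].
  rewrite big_geq// add0e; congr (P _).
  by apply/seteqP; split => w //= [].
rewrite IH big_nat_recr//= -addeA; congr (_ + _)%E.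
rewrite -measureU//; last first.
  by apply/seteqP; split => w //= [[-> _] []]; rewrite ltnn.
congr (P _); apply/seteqP; split => w /=.
  move=> [+ Fw]; rewrite leq_eqVlt => /orP[/eqP mw|mw]; [left|right] => //.
by case=> -[mw Fw]; split=> //; [rewrite mw|exact: ltnW].
Qed.

Lemma probability_upper_tail d (Omega : measurableType d) (R : realType)
    (P : probability Omega R) (X : {RV P >-> nat}) (b : nat -> R) (m : nat) :
  has_pmf X b ->
  P (X @^-1` [set k | (m <= k)%N]) = (upper_tail b m)%:E.
Proof.
move=> pmf.
have mX K : measurable (X @^-1` K) by exact: measurable_funPTI.
pose F k := if (m <= k)%N then X @^-1` [set k] else set0.
have PF k : P (F k) = (if (m <= k)%N then b k else 0)%:E.
  by rewrite /F; case: ifP => _; [exact: pmf|rewrite measure0].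
have -> : X @^-1` [set k | (m <= k)%N] = \bigcup_k F k.
  apply/seteqP; split => w /=.
    by move=> mw; exists (X w) => //; rewrite /F mw.
  by move=> [k _]; rewrite /F; case: ifP => // mk /= ->.
have tF : trivIset [set: nat] F.
  move=> k l _ _ [w []]; rewrite /F; case: ifP => // _; case: ifP => // _ /=.
  by move=> ->.
have mF k : measurable (F k) by rewrite /F; case: ifP.
have := measure_semi_sigma_additive (s := P) F mF tF (bigcupT_measurable _ mF).
have -> : (fun n => \sum_(0 <= i < n) P (F i))%E =
    EFin \o (fun n => \sum_(m <= i < n) b i).
  apply/funext => n /=; under eq_bigr do rewrite PF.
  rewrite sumEFin; congr EFin; rewrite -big_mkcond/=.
  by rewrite [RHS](big_nat_widenl _ 0%N).
have PU : P (\bigcup_k F k) \is a fin_num.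
  by rewrite fin_num_measure//; exact: bigcupT_measurable.
move=> cvgP.
have h : \sum_(m <= i < n) b i @[n --> \oo] --> (fine (P (\bigcup_k F k)) : R).
  by move: cvgP; rewrite -[X in _ --> X](fineK PU); move/fine_cvg.
by rewrite -(fineK PU); congr EFin; exact/esym/(cvg_lim (@Rhausdorff R) h).
Qed.

(** The bound [m < N] ensures that the arriving customer is admitted. *)
Lemma single_transition (R : realType) (c N j m : nat)
    d (Omega : measurableType d) (P : probability Omega R)
    (V T S : nat -> {RV P >-> R}) (p : nat -> nat -> R) :
  transition_probabilities P N (single_found c N V T S) p ->
  (m < N)%N -> (j <= N)%N ->
  p m j = fine (P [set w | left_after_service c j
                     [tuple single_sample V T S m k w | k < m.+2]]).
Proof.
move=> tr mN jN.
have L0 : single_found c N V T S m 0 @^-1` [set m] = setT.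
  by apply/seteqP; split => // w _; rewrite /= /single_found /= size_mkseq.
rewrite (tr m 0%N m j) ?(ltnW mN)//; last first.
  by rewrite L0 probability_setT oner_neq0.
rewrite /cond_prob L0 setIT probability_setT divr1.
congr (fine (P _)); apply/funext => w.
rewrite /preimage /mkset.
rewrite (left_after_serviceE c _ j (fun k => single_sample V T S m k)) /=.
rewrite /single_found /= /admit_single size_mkseq mN.
congr (size (serve _ _ _) = _).
rewrite /mkseq -addn1 iotaD map_cat /= cats1 add0n ltnn; congr rcons.
by apply/eq_in_map => k; rewrite mem_iota /= => ->.
Qed.

Lemma batch_transition (R : realType) (c N i j : nat)
    d (Omega : measurableType d) (P : probability Omega R)
    (V T : nat -> {RV P >-> R}) (X : nat -> {RV P >-> nat})
    (S : nat -> nat -> {RV P >-> R}) (pstar : nat -> nat -> R) :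
  transition_probabilities P N (batch_found c N V T X S) pstar ->
  (i <= N)%N -> (j <= N)%N ->
  pstar i j = fine (P (batch_found c N V T X S i 1 @^-1` [set j])).
Proof.
move=> tr iN jN.
have L0 : batch_found c N V T X S i 0 @^-1` [set i] = setT.
  by apply/seteqP; split => // w _; rewrite /= /batch_found /= size_mkseq.
rewrite (tr i 0%N i j)//; last by rewrite L0 probability_setT oner_neq0.
by rewrite /cond_prob L0 setIT probability_setT divr1.
Qed.

(** The number of admitted customers is random; restricting to batch sizes that
    all fill the system to the same level [n] fixes the length of the tuple. A
    single size is one case, all sizes that fill the system up another. *)
Lemma batch_found_given_size (R : realType) (c N i j n : nat)
    d (Omega : measurableType d) (P : probability Omega R)
    (V T : nat -> {RV P >-> R}) (X : nat -> {RV P >-> nat})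
    (S : nat -> nat -> {RV P >-> R}) (K : set nat) :
  (forall k, K k -> (i + minn k (N - i))%N = n) ->
  X 0%N @^-1` K `&` batch_found c N V T X S i 1 @^-1` [set j] =
  X 0%N @^-1` K `&` [set w | left_after_service c j
                       [tuple batch_sample V T S i k w | k < n.+1]].
Proof.
move=> Kn; apply/funext => w; apply/propext.
suff E : K (X 0%N w) -> (batch_found c N V T X S i 1 w = j) =
    (left_after_service c j [tuple batch_sample V T S i k w | k < n.+1]).
  by split => -[Kw]; [rewrite [X in X -> _]E|rewrite -[X in X -> _]E].
move=> /Kn <-.
rewrite (left_after_serviceE c _ j (fun k => batch_sample V T S i k)).
rewrite /batch_found /= /admit_batch size_mkseq; congr (size (serve _ _ _) = _).
rewrite /mkseq iotaD map_cat add0n; congr cat.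
  by apply/eq_in_map => k; rewrite mem_iota /= => ->.
have iotaE l : iota i l = map (addn i) (iota 0 l) by rewrite -iotaDl addn0.
rewrite iotaE -map_comp.
apply: eq_map => k /=.
by rewrite ltnNge leq_addr /= addKn.
Qed.

Theorem lemma3p3 (R : realType) (c N : nat) (mu : R) (A : R -> R) (b : nat -> R)
  (d1 : measure_display) (Omega1 : measurableType d1) (P1 : probability Omega1 R)
  (V1 T1 S1 : nat -> {RV P1 >-> R})
  (d2 : measure_display) (Omega2 : measurableType d2) (P2 : probability Omega2 R)
  (V2 T2 : nat -> {RV P2 >-> R}) (X2 : nat -> {RV P2 >-> nat})
  (S2 : nat -> nat -> {RV P2 >-> R})
  (p pstar : nat -> nat -> R) :
  (1 <= c)%N -> (c <= N)%N -> 0 < mu ->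
  (forall t : R, t < 0 -> A t = 0) ->
  b 0%N = 0 ->
  GI_M_c_N A mu V1 T1 S1 ->
  GIX_M_c_N A b mu V2 T2 X2 S2 ->
  transition_probabilities P1 N (single_found c N V1 T1 S1) p ->
  transition_probabilities P2 N (batch_found c N V2 T2 X2 S2) pstar ->
  forall i j : nat, (i <= N)%N -> (j <= N)%N ->
    pstar i j = \sum_(1 <= k < N - i) p (i + k - 1)%N j * b k
                + p (N - 1)%N j * upper_tail b (N - i).
Proof.
move=> c_gt0 cN _ _ b0 single batch tr1 tr2 i j iN jN.
have N_gt0 : (0 < N)%N := leq_trans c_gt0 cN.
pose F := batch_found c N V2 T2 X2 S2 i 1 @^-1` [set j].
pose G n := [set w | left_after_service c j
  [tuple batch_sample V2 T2 S2 i k w | k < n.+1]].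
have mX K : measurable (X2 0%N @^-1` K) by exact: measurable_funPTI.
have mG n : measurable (G n).
  exact: (measurable_left_after_service_sample _ _ _ (batch_sample V2 T2 S2 i)).
have mF : measurable F.
  have -> : F = \bigcup_k (X2 0%N @^-1` [set k] `&` F).
    apply/seteqP; split => w; last by case=> k _ [].
    by move=> Fw; exists (X2 0%N w).
  apply: bigcupT_measurable => k.
  rewrite (@batch_found_given_size _ _ _ _ _ (i + minn k (N - i))%N)//.
    by apply: measurableI; [exact: mX|exact: mG].
  by move=> _ ->.
(* [n] customers are present after the batch, as after a single arrival that
   found [n - 1]. *)
have PK n (K : set nat) : (0 < n <= N)%N ->
    (forall k, K k -> (i + minn k (N - i))%N = n) ->
    P2 (X2 0%N @^-1` K `&` F) = (P2 (X2 0%N @^-1` K) * (p n.-1 j)%:E)%E.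
  case: n => [//|m] /= mN Kn.
  rewrite (batch_found_given_size _ _ _ _ _ _ Kn).
  rewrite (batch_service_law _ _ m _ _ single batch).
  rewrite (single_transition tr1 mN jN) fineK// fin_num_measure//.
  exact: (measurable_left_after_service_sample _ _ _
    (single_sample V1 T1 S1 m)).
rewrite (batch_transition tr2 iN jN) -/F.
rewrite (probability_split_nat (X2 0%N) (N - i) mF).
rewrite (PK N); last 2 first.
- by rewrite N_gt0 /=.
- by move=> k /= /minn_idPr ->; rewrite subnKC.
rewrite (probability_upper_tail _ (batch_size batch 0%N)).
rewrite (eq_big_nat _ _ (F2 := fun k => (p (i + k - 1)%N j * b k)%:E));
  last first.
  move=> k /andP[_ kNi].
  have Pk : P2 (X2 0%N @^-1` [set k]) = (b k)%:E := batch_size batch 0%N k.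
  (* An empty batch would leave the level at [i], which may be zero; as its
     probability is zero, the truncated [i + 0 - 1] is harmless. *)
  case: k => [|k] in kNi Pk *.
    rewrite b0 mulr0; apply/eqP; rewrite -measure_le0.
    apply: le_trans (measureIl _ _ _) _ => //.
    by rewrite [X in (X <= _)%E]Pk b0.
  rewrite (PK (i + k.+1)%N).
  - by rewrite Pk -EFinM mulrC subn1.
  - by rewrite addnS /= -ltn_subRL ltnW.
  - by move=> _ ->; rewrite (minn_idPl _)// ltnW.
rewrite sumEFin -EFinM -EFinD /= -subn1 [upper_tail _ _ * _]mulrC.
congr (_ + _); case: (N - i)%N => [|n]; first by rewrite !big_geq.
by rewrite big_ltn// b0 mulr0 add0r.
Qed.
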